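(* Let $q,a,b$ be nonzero complex numbers with $|q|<1$ and $\max\{|ab|,|aq^2|,|bq^2|\}<1$. Then $$\frac{(q^2,ab;q^2)_\infty}{(aq^2,bq^2;q^2)_\infty}\;{}_3\phi_2\left(\begin{matrix}q^2/a,\,q^2/b,\,q\\ 0,\,q^3\end{matrix};q^2,ab\right)=(1-q)\sum_{n=0}^\infty\sum_{j=-n}^n(-1)^n(1+q^{2n+1})\frac{(q^2/a,q^2/b;q^2)_n}{(aq^2,bq^2;q^2)_n}(ab)^nq^{n^2+2j^2-j}.$$
   Context: Notation, for a base $p$ with $|p|<1$: $(x;p)_0=1$, $(x;p)_n=\prod_{k=0}^{n-1}(1-xp^k)$, $(x;p)_\infty=\prod_{k=0}^\infty(1-xp^k)$, $(x_1,\dots,x_k;p)_n=(x_1;p)_n\cdots(x_k;p)_n$ (also for $n=\infty$), and $${}_3\phi_2\left(\begin{matrix}A_1,A_2,A_3\\ B_1,B_2\end{matrix};p,z\right)=\sum_{n=0}^\infty\frac{(A_1,A_2,A_3;p)_n}{(p,B_1,B_2;p)_n}z^n .$$ *)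

(* Defs.v *)
From Stdlib Require Import Reals ZArith.
From Coquelicot Require Import Coquelicot.

Open Scope C_scope.

(* [iota] picks the unique limit when there is one (iota_filterlim_locally);
   the value is irrelevant for a divergent sequence. *)
Definition CLim_seq (u : nat -> C) : C :=
  iota (T := CompleteNormedModule.CompleteSpace _ C_CompleteNormedModule)
    (fun l : C => filterlim u eventually (locally l)).

(* [sum_n a N] is the sum of a 0, ..., a N. *)
Definition CSeries (a : nat -> C) : C := CLim_seq (sum_n a).

Fixpoint qpoch (x p : C) (n : nat) : C :=
  match n with
  | O => 1
  | S m => qpoch x p m * (1 - x * p ^ m)
  end.

Definition qpoch_inf (x p : C) : C := CLim_seq (qpoch x p).

Definition phi32_term (A1 A2 A3 B1 B2 p z : C) (n : nat) : C :=
  (qpoch A1 p n * qpoch A2 p n * qpoch A3 p n)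
  / (qpoch p p n * qpoch B1 p n * qpoch B2 p n) * z ^ n.

Definition phi32 (A1 A2 A3 B1 B2 p z : C) : C :=
  CSeries (phi32_term A1 A2 A3 B1 B2 p z).

Definition Cpowz (x : C) (m : Z) : C :=
  match m with
  | Z0 => 1
  | Zpos k => x ^ Pos.to_nat k
  | Zneg k => / (x ^ Pos.to_nat k)
  end.

(* The sum of f j over the integers -n <= j <= n, via j = k - n. *)
Definition sum_sym (f : Z -> C) (n : nat) : C :=
  sum_n (fun k => f (Z.of_nat k - Z.of_nat n)%Z) (2 * n).

Definition hecke_term (q a b : C) (n : nat) : C :=
  sum_sym (fun j : Z =>
    (- (1)) ^ n * (1 + q ^ (2 * n + 1))
    * ((qpoch (q ^ 2 / a) (q ^ 2) n * qpoch (q ^ 2 / b) (q ^ 2) n)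
       / (qpoch (a * q ^ 2) (q ^ 2) n * qpoch (b * q ^ 2) (q ^ 2) n))
    * (a * b) ^ n
    * Cpowz q (Z.of_nat n ^ 2 + 2 * j ^ 2 - j)%Z) n.

(* Main.v *)
Require Import Defs.
From Stdlib Require Import Reals ZArith Lra Lia.
From Coquelicot Require Import Coquelicot.
Open Scope C_scope.

(** Write [p = q^2] and [T_r = sum_{|j| <= r} q^(2j^2-j)].  Bailey's lemma with
    parameters [rho1 = p/a], [rho2 = p/b], relative to [p], is applied to the pair
    [alpha_r = (-1)^r (1 + q^(2r+1)) q^(r^2) T_r],
    [beta_n = 1 / ((1 - q^(2n+1)) (p;p)_n)].

    That this is a Bailey pair follows by summation by parts: the tail sums
    [sum_{r >= j} (-1)^r (1 + q^(2r+1)) q^(r^2) / ((p;p)_{n-r} (p;p)_{n+r+1})]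
    equal [(-1)^j q^(j^2) / ((1 - q^(2n+1)) (p;p)_{n-j} (p;p)_{n+j})], which leaves
    the finite pentagonal number theorem
    [sum_{|j| <= n} (-1)^j p^(j(3j-1)/2) / ((p;p)_{n-j} (p;p)_{n+j}) = 1/(p;p)_n].

    Bailey's lemma is first proved for sums truncated at [N], where it reduces to
    the terminating q-Pfaff-Saalschuetz sum; Tannery's theorem then lets [N] tend
    to infinity on both sides.  The Saalschuetz and pentagonal sums are both
    obtained by the Wilf-Zeilberger method. *)

(** * Finite sums and the q-Pfaff-Saalschuetz sum *)

(* Terms built with [sum_n] live in a canonical-structure carrier that [ring]
   and [field] do not recognise as [C]. *)
Ltac eqC := match goal with |- ?a = ?b => change (@eq C a b) end.

Lemma Csum_S (u : nat -> C) (n : nat) : sum_n u (S n) = sum_n u n + u (S n).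
Proof. exact (sum_Sn u n). Qed.

Lemma Csum_0 (u : nat -> C) : sum_n u 0 = u 0%nat.
Proof. exact (sum_O u). Qed.

Lemma Csum_eq (u v : nat -> C) (n : nat) :
  (forall k, (k <= n)%nat -> u k = v k) -> sum_n u n = sum_n v n.
Proof. exact (sum_n_ext_loc u v n). Qed.

Lemma Csum_mult_l (c : C) (u : nat -> C) (n : nat) :
  sum_n (fun k => c * u k) n = c * sum_n u n.
Proof.
induction n as [|n IH]; [now rewrite !Csum_0|].
rewrite !Csum_S, IH. eqC. ring.
Qed.

Lemma Csum_minus (u v : nat -> C) (n : nat) :
  sum_n (fun k => u k - v k) n = sum_n u n - sum_n v n.
Proof.
induction n as [|n IH]; [now rewrite !Csum_0|].
rewrite !Csum_S, IH. eqC. ring.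
Qed.

Lemma Csum_plus (u v : nat -> C) (n : nat) :
  sum_n (fun k => u k + v k) n = sum_n u n + sum_n v n.
Proof.
induction n as [|n IH]; [now rewrite !Csum_0|].
rewrite !Csum_S, IH. eqC. ring.
Qed.

(** Interchange of summation over [r <= j <= N]; the substitution [j = r + k] makes the new inner
    sum start at 0, as the Saalschuetz sum requires. *)
Lemma Csum_triangle (g : nat -> nat -> C) (N : nat) :
  sum_n (fun j => sum_n (fun r => g j r) j) N
  = sum_n (fun r => sum_n (fun k => g (r + k)%nat r) (N - r)) N.
Proof.
induction N as [|N IH]; [now rewrite !Csum_0|].
rewrite !Csum_S, IH, Nat.sub_diag, Csum_0, Nat.add_0_r, Cplus_assoc, <- Csum_plus.
f_equal. apply Csum_eq. intros r Hr.
rewrite (Nat.sub_succ_l r N Hr), Csum_S.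
now replace (r + S (N - r))%nat with (S N) by lia.
Qed.

Lemma Csolve_linear (k s b c : C) : k <> 0 -> k * s - b = c -> s = (b + c) / k.
Proof. intros Hk <-. field. exact Hk. Qed.

Lemma qpoch_S (x p : C) (n : nat) : qpoch x p (S n) = qpoch x p n * (1 - x * p ^ n).
Proof. reflexivity. Qed.

Lemma qpoch_add (x p : C) (r k : nat) :
  qpoch x p (r + k) = qpoch x p r * qpoch (x * p ^ r) p k.
Proof.
induction k as [|k IH].
- rewrite Nat.add_0_r. simpl. ring.
- rewrite Nat.add_succ_r, !qpoch_S, IH, Cpow_add_r. ring.
Qed.

Lemma qpoch_S_nz (x p : C) (n : nat) :
  qpoch x p (S n) <> 0 -> qpoch x p n <> 0 /\ 1 - x * p ^ n <> 0.
Proof.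
rewrite qpoch_S. intros H. split; intros E; apply H; rewrite E; ring.
Qed.

(** For generic [z] and up to the factor [(z;p)_M / (p;p)_M], this is the summand of the balanced
    3phi2 with upper parameters [x, y, p^(-M)], lower parameters [x y z, p^(1-M) / z] and argument
    [p]. The symbols of index [M - k] keep negative powers out. *)
Definition saalschutz_term (p x y z : C) (M k : nat) : C :=
  qpoch x p k * qpoch y p k * qpoch z p (M - k) * z ^ k
  / (qpoch p p k * qpoch p p (M - k) * qpoch (x * y * z) p k).

(* The right-hand side is the Wilf-Zeilberger certificate for the recurrence
   in [M = n + m]; only the partial sum up to [n <= M] is needed. *)
Lemma saalschutz_wz (p x y z : C) (m n : nat) :
  (forall k, qpoch p p k <> 0) -> (forall k, qpoch (x * y * z) p k <> 0) ->
  sum_n (fun k =>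
    (1 - p * p ^ (n + m)) * (1 - x * y * z * p ^ (n + m))
      * saalschutz_term p x y z (S (n + m)) k
    - (1 - y * z * p ^ (n + m)) * (1 - x * z * p ^ (n + m))
      * saalschutz_term p x y z (n + m) k) n
  = - (z * p ^ m * (qpoch x p (S n) * qpoch y p (S n) * z ^ n * qpoch z p m)
       / (qpoch p p n * qpoch p p m * qpoch (x * y * z) p n)).
Proof.
intros Hp Hc. revert m. induction n as [|n IH]; intros m.
- rewrite Csum_0. unfold saalschutz_term. rewrite !Nat.sub_0_r. simpl (0 + m)%nat.
  destruct (qpoch_S_nz _ _ _ (Hp (S m))).
  rewrite !qpoch_S. simpl. eqC. field. auto.
(* The parameter [M = n + m] stays fixed while the partial sum grows, so the induction hypothesis is
   taken at [S m]. *)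
- rewrite Csum_S. replace (S n + m)%nat with (n + S m)%nat by lia. rewrite IH.
  unfold saalschutz_term.
  replace (S (n + S m) - S n)%nat with (S m) by lia.
  replace (n + S m - S n)%nat with m by lia.
  destruct (qpoch_S_nz _ _ _ (Hp (S m))).
  destruct (qpoch_S_nz _ _ _ (Hp (S n))).
  destruct (qpoch_S_nz _ _ _ (Hc (S n))).
  rewrite !qpoch_S, !Cpow_add_r, !Cpow_S.
  eqC. field. repeat split; auto.
Qed.

Lemma pfaff_saalschutz (p x y z : C) (M : nat) :
  (forall k, qpoch p p k <> 0) -> (forall k, qpoch (x * y * z) p k <> 0) ->
  sum_n (saalschutz_term p x y z M) M
  = qpoch (y * z) p M * qpoch (x * z) p M / (qpoch p p M * qpoch (x * y * z) p M).
Proof.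
intros Hp Hc. induction M as [|M IH].
- rewrite Csum_0. unfold saalschutz_term. simpl. eqC. field.
(* At [m = 0] the certificate covers all [k <= M]; the term [k = S M], present only in the sum for
   [S M], is added after solving. *)
- generalize (saalschutz_wz p x y z 0 M Hp Hc). rewrite Nat.add_0_r.
  rewrite Csum_minus, !Csum_mult_l, IH. intros E.
  destruct (qpoch_S_nz _ _ _ (Hp (S M))) as [H1 H2].
  destruct (qpoch_S_nz _ _ _ (Hc (S M))) as [H3 H4].
  apply Csolve_linear in E; [|now apply Cmult_neq_0].
  rewrite Csum_S, E. unfold saalschutz_term. rewrite Nat.sub_diag, !qpoch_S, !Cpow_S. simpl. eqC.
  field. auto.
Qed.

(** * The truncated Bailey lemma *)

(** After the interchange with [j = r + k], the sum over [k] is a Saalschuetz sum with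
    [x = p^(r+1) / a], [y = p^(r+1) / b], [z = a b]; the weight in [N - j] supplies its symbols of
    index [M - k]. *)
Lemma bailey_finite (p a b : C) (alpha : nat -> C) (N : nat) :
  a <> 0 -> b <> 0 -> p <> 0 ->
  (forall k, qpoch p p k <> 0) ->
  (forall k, qpoch (a * p) p k <> 0) -> (forall k, qpoch (b * p) p k <> 0) ->
  sum_n (fun j =>
    qpoch (p / a) p j * qpoch (p / b) p j * (a * b) ^ j
    * sum_n (fun r => alpha r / (qpoch p p (j - r) * qpoch p p (j + r + 1))) j
    * (qpoch (a * b) p (N - j) / qpoch p p (N - j))) N
  = sum_n (fun r =>
    (qpoch (p / a) p r * qpoch (p / b) p r)
    / (qpoch (a * p) p r * qpoch (b * p) p r) * (a * b) ^ r * alpha r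
    * (qpoch (a * p) p N * qpoch (b * p) p N
       / (qpoch p p (N - r) * qpoch p p (N + r + 1)))) N.
Proof.
intros Ha Hb Hp0 Hp Hap Hbp.
set (G := fun j r => qpoch (p / a) p j * qpoch (p / b) p j * (a * b) ^ j
    * (qpoch (a * b) p (N - j) / qpoch p p (N - j))
    * (alpha r / (qpoch p p (j - r) * qpoch p p (j + r + 1)))).
transitivity (sum_n (fun j => sum_n (G j) j) N).
{ apply Csum_eq. intros j _. unfold G. rewrite Csum_mult_l. eqC. ring. }
rewrite Csum_triangle. apply Csum_eq. intros r Hr.
set (M := (N - r)%nat). assert (EN : N = (r + M)%nat) by (unfold M; lia).
clearbody M.
assert (Hpr : p ^ r <> 0) by now apply Cpow_nz.
set (x := p / a * p ^ r). set (y := p / b * p ^ r). set (z := a * b).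
(* By this value [qpoch_add] splits [qpoch p p (r + r + 1 + k)] into a factor free of [k] and
   [qpoch (x * y * z) p k], which is therefore nonzero. *)
assert (Exyz : x * y * z = p * p ^ (r + r + 1)).
{ unfold x, y, z. rewrite !Cpow_add_r. simpl. field. auto. }
assert (Hxz : x * z = b * p * p ^ r) by (unfold x, z; field; auto).
assert (Hyz : y * z = a * p * p ^ r) by (unfold y, z; field; auto).
assert (Hc : forall k, qpoch (x * y * z) p k <> 0).
{ intros k E. apply (Hp (r + r + 1 + k)%nat).
  rewrite qpoch_add, <- Exyz, E. ring. }
transitivity (qpoch (p / a) p r * qpoch (p / b) p r * z ^ r * alpha r
   / qpoch p p (r + r + 1) * sum_n (saalschutz_term p x y z M) M).
{ rewrite <- Csum_mult_l. apply Csum_eq. intros k Hk. unfold G, saalschutz_term.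
  replace (N - (r + k))%nat with (M - k)%nat by lia.
  replace (r + k - r)%nat with k by lia.
  replace (r + k + r + 1)%nat with (r + r + 1 + k)%nat by lia.
  rewrite !qpoch_add with (k := k), Cpow_add_r, <- Exyz.
  fold x y z. eqC. field. auto. }
rewrite pfaff_saalschutz by auto. rewrite Hxz, Hyz, EN.
replace (r + M + r + 1)%nat with (r + r + 1 + M)%nat by lia.
assert (Ha' := Hap (r + M)%nat). assert (Hb' := Hbp (r + M)%nat).
rewrite !qpoch_add with (k := M), <- Exyz in *.
eqC. field. repeat split; auto.
Qed.

(** * The Bailey pair *)

(* [pent p n = (-1)^n p^(n(3n-1)/2)], without a division in the exponent. *)
Fixpoint pent (p : C) (n : nat) : C :=
  match n with
  | O => 1
  | S m => - pent p m * p ^ (3 * m + 1)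
  end.

(* The terms of index [j] and [-j] of the pentagonal sum together. *)
Definition pent_sym (p : C) (j : nat) : C :=
  match j with
  | O => 1
  | S _ => pent p j * (1 + p ^ j)
  end.

(** Wilf-Zeilberger certificate, with [n = j + m], for the recurrence [(1 - p^(n+1)) S_(n+1) = S_n]
    of the pentagonal sums, which [1 / (p;p)_n] also satisfies. *)
Lemma pent_wz (p : C) (m j : nat) :
  (forall k, qpoch p p k <> 0) ->
  sum_n (fun i =>
    (1 - p ^ (j + m + 1)) * (pent_sym p i
      / (qpoch p p (j + m + 1 - i) * qpoch p p (j + m + 1 + i)))
    - pent_sym p i / (qpoch p p (j + m - i) * qpoch p p (j + m + i))) j
  = pent p j * p ^ (2 * j) * p ^ (j + m + 1)
    / (qpoch p p m * qpoch p p (j + m + 1 + j)).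
Proof.
intros Hp. revert m. induction j as [|j IH]; intros m.
- rewrite Csum_0. simpl (0 + m)%nat. rewrite !Nat.sub_0_r, !Nat.add_0_r, Nat.add_1_r.
  destruct (qpoch_S_nz _ _ _ (Hp (S m))).
  rewrite !qpoch_S. simpl. eqC. field. auto.
- rewrite Csum_S. replace (S j + m)%nat with (j + S m)%nat by lia. rewrite IH.
  replace (j + S m + 1 - S j)%nat with (S m) by lia.
  replace (j + S m - S j)%nat with m by lia.
  replace (j + S m + 1 + j)%nat with (S (S (j + j + m))) by lia.
  replace (j + S m + 1 + S j)%nat with (S (S (S (j + j + m)))) by lia.
  replace (j + S m + S j)%nat with (S (S (j + j + m))) by lia.
  destruct (qpoch_S_nz _ _ _ (Hp (S m))).
  destruct (qpoch_S_nz _ _ _ (Hp (S (S (S (j + j + m)))))) as [H1 H2].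
  destruct (qpoch_S_nz _ _ _ H1) as [H3 H4].
  destruct (qpoch_S_nz _ _ _ H3) as [H5 H6].
  replace (2 * S j)%nat with (j + j + 2)%nat by lia.
  replace (2 * j)%nat with (j + j)%nat by lia.
  unfold pent_sym, pent. fold (pent p j).
  replace (3 * j + 1)%nat with (j + j + j + 1)%nat by lia.
  repeat rewrite ?qpoch_S, ?Cpow_S, ?Cpow_add_r in *.
  set (c := p ^ j) in *. set (d := p ^ m) in *. simpl in *.
  eqC. field. repeat split; auto.
Qed.

Lemma pentagonal_finite (p : C) (n : nat) :
  (forall k, qpoch p p k <> 0) ->
  sum_n (fun j => pent_sym p j / (qpoch p p (n - j) * qpoch p p (n + j))) n
  = / qpoch p p n.
Proof.
intros Hp. induction n as [|n IH].
- rewrite Csum_0. simpl. eqC. field.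
(* At [m = 0] the right-hand side of the certificate cancels against [1 - p^(n+1)] times the term of
   index [S n], leaving exactly the recurrence. *)
- generalize (pent_wz p 0 n Hp). rewrite Nat.add_0_r.
  rewrite Csum_minus, Csum_mult_l, IH, Nat.add_1_r.
  rewrite Csum_S, Nat.sub_diag. intros E.
  replace (S n + S n)%nat with (S (S n + n)) by lia.
  destruct (qpoch_S_nz _ _ _ (Hp (S n))) as [H1 H2].
  destruct (qpoch_S_nz _ _ _ (Hp (S (S n + n)))) as [H3 H4].
  apply Csolve_linear in E; [|exact H2].
  rewrite E.
  replace (2 * n)%nat with (n + n)%nat by lia.
  unfold pent_sym, pent. fold (pent p n).
  replace (3 * n + 1)%nat with (n + n + n + 1)%nat by lia.
  rewrite (qpoch_S p p (S n + n)), (qpoch_S p p n); repeat rewrite ?Cpow_S, ?Cpow_add_r in *.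
  set (c := p ^ n) in *. set (d := qpoch p p (S n + n)) in *.
  change (qpoch p p 0) with (RtoC 1). simpl. eqC. field.
  repeat split; auto.
Qed.

(* Closes the side conditions of [field], which come back in expanded form. *)
Ltac nonzero :=
  repeat split; try assumption;
  match goal with
  | H : ?x <> _ |- ?a <> _ =>
      let E := fresh in intros E; apply H; rewrite <- E; ring
  end.

(** * Symmetric sums, partial theta sums and the Bailey pair built from them *)

Lemma Cpowz_nat (x : C) (k : nat) : Cpowz x (Z.of_nat k) = x ^ k.
Proof.
destruct k as [|k]; [reflexivity|].
simpl Z.of_nat. unfold Cpowz. now rewrite SuccNat2Pos.id_succ.
Qed.

Lemma Csum_shift (u : nat -> C) (n : nat) :
  sum_n u (S n) = u 0%nat + sum_n (fun k => u (S k)) n.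
Proof.
induction n as [|n IH].
- now rewrite Csum_S, !Csum_0.
- rewrite Csum_S, IH, (Csum_S (fun k => u (S k))). eqC. ring.
Qed.

Lemma sum_sym_0 (f : Z -> C) : sum_sym f 0 = f 0%Z.
Proof. unfold sum_sym. now rewrite Csum_0. Qed.

Lemma sum_sym_S (f : Z -> C) (n : nat) :
  sum_sym f (S n) = sum_sym f n + f (Z.of_nat (S n)) + f (- Z.of_nat (S n))%Z.
Proof.
unfold sum_sym. replace (2 * S n)%nat with (S (S (2 * n))) by lia.
rewrite Csum_S, Csum_shift.
replace (Z.of_nat 0 - Z.of_nat (S n))%Z with (- Z.of_nat (S n))%Z by lia.
replace (Z.of_nat (S (S (2 * n))) - Z.of_nat (S n))%Z with (Z.of_nat (S n)) by lia.
rewrite (Csum_eq _ (fun k => f (Z.of_nat k - Z.of_nat n)%Z)).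
- eqC. ring.
- intros k _. f_equal. lia.
Qed.

Definition theta (q : C) (n : nat) : C :=
  sum_sym (fun j => Cpowz q (2 * j ^ 2 - j)) n.

(** The indices [n + 1] and [-(n + 1)] contribute the exponents [(n+1)(2n+1)] and [(n+1)(2n+3)],
    both natural, so integer powers disappear. *)
Lemma theta_S (q : C) (n : nat) :
  theta q (S n) = theta q n + q ^ (S n * (2 * n + 1)) * (1 + q ^ (2 * S n)).
Proof.
unfold theta. rewrite sum_sym_S.
replace (2 * Z.of_nat (S n) ^ 2 - Z.of_nat (S n))%Z
  with (Z.of_nat (S n * (2 * n + 1))) by nia.
replace (2 * (- Z.of_nat (S n)) ^ 2 - - Z.of_nat (S n))%Z
  with (Z.of_nat (S n * (2 * n + 1) + 2 * S n)) by nia.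
rewrite !Cpowz_nat, Cpow_add_r. ring.
Qed.

Lemma Cpow_sqr (x : C) (n : nat) : (x ^ 2) ^ n = x ^ n * x ^ n.
Proof. simpl. rewrite !Cpow_mult_l, Cpow_1_l. ring. Qed.

(** The exponent [n(3n-1)] splits as [n^2 + (2n^2 - n)]: a pentagonal term in base [q^2] is the
    weight [(-1)^n q^(n^2)] times the theta term of index [n]. This links summation by parts to the
    pentagonal sum. *)
Lemma pent_sqr (q : C) (n : nat) :
  pent (q ^ 2) (S n)
  = (- (1)) ^ S n * q ^ (S n * S n) * q ^ (S n * (2 * n + 1)).
Proof.
induction n as [|n IH].
- simpl. ring.
- change (pent (q ^ 2) (S (S n)))
    with (- pent (q ^ 2) (S n) * (q ^ 2) ^ (3 * S n + 1)).
  rewrite IH, Cpow_sqr.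
  replace (S (S n) * S (S n))%nat with (S n * S n + n + n + 3)%nat by ring.
  replace (S (S n) * (2 * S n + 1))%nat
    with (S n * (2 * n + 1) + n + n + n + n + 5)%nat by ring.
  replace (3 * S n + 1)%nat with (n + n + n + 4)%nat by ring.
  rewrite (Cpow_S _ (S n)), !Cpow_add_r. ring.
Qed.

Definition hecke_alpha (q : C) (r : nat) : C :=
  (- (1)) ^ r * (1 + q ^ (2 * r + 1)) * q ^ (r * r) * theta q r.

(* Summation by parts up to [k < n]; the last term is the boundary term. *)
Lemma hecke_abel (q : C) (m k : nat) :
  (forall i, qpoch (q ^ 2) (q ^ 2) i <> 0) ->
  let n := (S k + m)%nat in
  sum_n (fun r => (1 - q ^ (2 * n + 1)) * (hecke_alpha q r
    / (qpoch (q ^ 2) (q ^ 2) (n - r) * qpoch (q ^ 2) (q ^ 2) (n + r + 1)))) k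
  = sum_n (fun j => pent_sym (q ^ 2) j
    / (qpoch (q ^ 2) (q ^ 2) (n - j) * qpoch (q ^ 2) (q ^ 2) (n + j))) k
  - (- (1)) ^ S k * q ^ (S k * S k) * theta q k
    / (qpoch (q ^ 2) (q ^ 2) (n - S k) * qpoch (q ^ 2) (q ^ 2) (n + S k)).
Proof.
intros Hp. revert m. induction k as [|k IH]; intros m n.
- rewrite !Csum_0. unfold n. unfold hecke_alpha, theta. rewrite sum_sym_0.
  simpl (1 + m - 0)%nat. simpl (1 + m - 1)%nat. rewrite Nat.sub_0_r.
  replace (1 + m + 0 + 1)%nat with (S (S m)) by lia.
  replace (1 + m + 0)%nat with (S m) by lia.
  replace (1 + m + 1)%nat with (S (S m)) by lia.
  destruct (qpoch_S_nz _ _ _ (Hp (S (S m)))) as [H1 H2].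
  destruct (qpoch_S_nz _ _ _ H1) as [H3 H4].
  replace (2 * (1 + m) + 1)%nat with (m + m + 3)%nat by lia.
  rewrite !qpoch_S, !Cpow_sqr, !Cpow_S, !Cpow_add_r in *. simpl in *.
  eqC. field. nonzero.
- rewrite !Csum_S. unfold n. replace (S (S k) + m)%nat with (S k + S m)%nat by lia.
  rewrite (IH (S m)).
  replace (S k + S m - S k)%nat with (S m) by lia.
  replace (S k + S m - S (S k))%nat with m by lia.
  replace (S k + S m + S k + 1)%nat with (S (S (S (k + k + m)) + 1)) by lia.
  replace (S k + S m + S k)%nat with (S (S (k + k + m) + 1)) by lia.
  replace (S k + S m + S (S k))%nat with (S (S (S (k + k + m)) + 1)) by lia.
  destruct (qpoch_S_nz _ _ _ (Hp (S m))).
  destruct (qpoch_S_nz _ _ _ (Hp (S (S (S (k + k + m)) + 1)))) as [H1 H2].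
  (* The coefficients of [theta q k] match because the tail sums telescope; the theta increment
     times [(-1)^(k+1) q^((k+1)^2)] is the new pentagonal term. *)
  unfold hecke_alpha. rewrite theta_S.
  unfold pent_sym. rewrite pent_sqr.
  replace (S (S k) * S (S k))%nat with (S k * S k + k + k + 3)%nat by ring.
  replace (2 * S k + 1)%nat with (k + k + 3)%nat by ring.
  replace (2 * S k)%nat with (k + k + 2)%nat by ring.
  replace (2 * (S k + S m) + 1)%nat with (k + k + m + m + 5)%nat by ring.
  rewrite (Cpow_S _ (S k)).
  change (S (S (k + k + m)) + 1)%nat with (S (S (k + k + m) + 1)) in *.
  rewrite (qpoch_S _ _ m), (qpoch_S _ _ (S (S (k + k + m) + 1))) in *.
  rewrite !Cpow_sqr in *.
  replace (S (S (k + k + m) + 1)) with (k + k + m + 3)%nat in * by lia.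
  set (D := qpoch _ _ (k + k + m + 3)) in *.
  rewrite !Cpow_add_r in *.
  set (e := (- (1)) ^ S k) in *. set (x := q ^ (S k * S k)) in *.
  set (y := q ^ (S k * (2 * k + 1))) in *.
  rewrite ?(Cpow_S q k) in *. set (s := q ^ k) in *. set (t := q ^ m) in *. simpl in *.
  eqC. field. nonzero.
Qed.

(** Multiplied by [1 - q^(2n+1)], the sum becomes the pentagonal sum: [hecke_abel] handles [r < n],
    and its boundary term combines with the term [r = n]. *)
Lemma hecke_bailey_pair (q : C) (n : nat) :
  (forall i, qpoch (q ^ 2) (q ^ 2) i <> 0) -> 1 - q ^ (2 * n + 1) <> 0 ->
  sum_n (fun r => hecke_alpha q r
    / (qpoch (q ^ 2) (q ^ 2) (n - r) * qpoch (q ^ 2) (q ^ 2) (n + r + 1))) n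
  = / ((1 - q ^ (2 * n + 1)) * qpoch (q ^ 2) (q ^ 2) n).
Proof.
intros Hp Hq.
match goal with |- ?s = _ =>
  enough (E : (1 - q ^ (2 * n + 1)) * s - 0 = / qpoch (q ^ 2) (q ^ 2) n) end.
{ apply Csolve_linear in E; [|exact Hq]. rewrite E. eqC. field. auto. }
rewrite <- Csum_mult_l.
rewrite <- pentagonal_finite by exact Hp.
destruct n as [|k].
- rewrite !Csum_0. unfold hecke_alpha, theta. rewrite sum_sym_0. simpl.
  eqC. field. intros E. apply (Hp 1%nat). simpl. rewrite <- E. ring.
- rewrite !Csum_S. generalize (hecke_abel q 0 k Hp). cbv zeta.
  rewrite Nat.add_0_r. intros E. rewrite E.
  (* With [n = S k], the factors [1 + q^(2n+1)] and [1 - q^(2n+1)] cancel the last factor of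
     [(p;p)_(2n+1)]; subtracting the boundary term leaves the theta increment, that is, the last
     pentagonal term. *)
  unfold hecke_alpha. rewrite theta_S, Nat.sub_diag.
  replace (S k + S k + 1)%nat with (S (S k + S k)) by lia.
  unfold pent_sym. rewrite pent_sqr.
  destruct (qpoch_S_nz _ _ _ (Hp (S (S k + S k)))) as [H1 H2].
  rewrite (qpoch_S _ _ (S k + S k)), !Cpow_sqr in *.
  replace (2 * S k + 1)%nat with (S (S k + S k)) by lia.
  replace (2 * S k)%nat with (S k + S k)%nat by lia.
  rewrite (Cpow_S q (S k + S k)).
  set (D := qpoch _ _ (S k + S k)) in *.
  rewrite !(Cpow_add_r q (S k) (S k)) in *. set (s := q ^ S k) in *.
  set (e := (- (1)) ^ S k) in *. set (x := q ^ (S k * S k)) in *.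
  set (y := q ^ (S k * (2 * k + 1))) in *. simpl in *.
  eqC. field. nonzero.
Qed.

(** * Limits of complex sequences *)

(** Stated through the real sequence of distances, so that limit rules for real sequences apply. *)
Definition Ctends (u : nat -> C) (l : C) : Prop :=
  is_lim_seq (fun n => Cmod (u n - l)) 0.

Lemma Ctends_filterlim (u : nat -> C) (l : C) :
  Ctends u l -> filterlim u eventually (locally l).
Proof.
intros H. apply (proj2 (@filterlim_locally nat C_UniformSpace eventually _ u l)).
intros eps. apply is_lim_seq_spec in H. destruct (H eps) as [N HN].
exists N. intros n Hn. specialize (HN n Hn).
apply C_NormedModule_mixin_compat1.
rewrite Rminus_0_r in HN. apply Rle_lt_trans with (2 := HN). apply Rle_abs.
Qed.

Lemma filterlim_Ctends (u : nat -> C) (l : C) :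
  filterlim u eventually (locally l) -> Ctends u l.
Proof.
intros H. apply is_lim_seq_spec. intros eps.
(* A ball of radius [e] in [C] is coordinatewise and only guarantees modulus below [sqrt 2 * e],
   whence half of [eps]. *)
assert (P : (0 < eps / 2)%R) by (destruct eps; simpl; lra).
destruct (proj1 (@filterlim_locally nat C_UniformSpace eventually _ u l) H
  (mkposreal _ P)) as [N HN].
exists N. intros n Hn. specialize (HN n Hn).
apply C_NormedModule_mixin_compat2 in HN.
change (minus (u n) l) with (u n - l) in HN. simpl in HN.
rewrite Rminus_0_r, Rabs_pos_eq by apply Cmod_ge_0.
assert (sqrt 2 <= 2)%R
  by (rewrite <- (sqrt_square 2) at 2 by lra; apply sqrt_le_1; lra).
destruct eps as [e He]; simpl in *. nra.
Qed.

Lemma Ctends_CLim (u : nat -> C) (l : C) : Ctends u l -> CLim_seq u = l.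
Proof.
intros H%Ctends_filterlim.
exact (@iota_filterlim_locally C_AbsRing C_CompleteNormedModule nat eventually
  (Proper_StrongProper _ eventually_filter) u l H).
Qed.

Lemma Ctends_unique (u : nat -> C) (l l' : C) : Ctends u l -> Ctends u l' -> l = l'.
Proof. intros H%Ctends_CLim H'%Ctends_CLim. congruence. Qed.

Lemma ex_series_Ctends (u : nat -> C) (l : C) :
  Ctends (sum_n u) l -> @ex_series C_AbsRing C_NormedModule u.
Proof. intros H. exists l. exact (Ctends_filterlim _ _ H). Qed.

Lemma ex_series_sum_n (u : nat -> C) (b : nat -> R) :
  (forall n, Cmod (u n) <= b n)%R -> ex_series b -> Ctends (sum_n u) (CSeries u).
Proof.
intros H Hb. destruct (@ex_series_le C_AbsRing C_CompleteNormedModule u b H Hb) as [l Hl].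
assert (Hl' : Ctends (sum_n u) l) by exact (filterlim_Ctends _ _ Hl).
unfold CSeries. now rewrite (Ctends_CLim _ _ Hl').
Qed.

Lemma Ctends_le (u : nat -> C) (l : C) (v : nat -> R) :
  (forall n, Cmod (u n - l) <= v n)%R -> is_lim_seq v 0 -> Ctends u l.
Proof.
intros H Hv. apply (is_lim_seq_le_le (fun _ => 0%R) _ v); [|apply is_lim_seq_const|exact Hv].
intros n. split; [apply Cmod_ge_0|apply H].
Qed.

Lemma Ctends_ext (u v : nat -> C) (l : C) :
  (forall n, u n = v n) -> Ctends u l -> Ctends v l.
Proof. intros H. apply is_lim_seq_ext. intros n. now rewrite H. Qed.

Lemma Ctends_const (l : C) : Ctends (fun _ => l) l.
Proof.
apply Ctends_le with (fun _ => 0%R); [|apply is_lim_seq_const].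
intros _. replace (l - l) with (RtoC 0) by ring. rewrite Cmod_0. lra.
Qed.

Lemma Ctends_plus (u v : nat -> C) (l m : C) :
  Ctends u l -> Ctends v m -> Ctends (fun n => u n + v n) (l + m).
Proof.
intros Hu Hv. apply Ctends_le with (fun n => Cmod (u n - l) + Cmod (v n - m))%R.
- intros n. replace (u n + v n - (l + m)) with ((u n - l) + (v n - m)) by ring.
  apply Cmod_triangle.
- replace 0%R with (0 + 0)%R by ring. now apply is_lim_seq_plus'.
Qed.

Lemma Ctends_mult (u v : nat -> C) (l m : C) :
  Ctends u l -> Ctends v m -> Ctends (fun n => u n * v n) (l * m).
Proof.
intros Hu Hv.
apply Ctends_le with (fun n => Cmod (u n - l) * Cmod (v n - m)
  + (Cmod m * Cmod (u n - l) + Cmod l * Cmod (v n - m)))%R.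
- intros n.
  replace (u n * v n - l * m)
    with ((u n - l) * (v n - m) + (m * (u n - l) + l * (v n - m))) by ring.
  rewrite <- !Cmod_mult. eapply Rle_trans; [apply Cmod_triangle|].
  apply Rplus_le_compat_l, Cmod_triangle.
- replace 0%R with (0 * 0 + (Cmod m * 0 + Cmod l * 0))%R by ring.
  apply is_lim_seq_plus'; [now apply is_lim_seq_mult'|].
  apply is_lim_seq_plus';
    (apply is_lim_seq_mult'; [apply is_lim_seq_const|assumption]).
Qed.

Lemma Ctends_le_Cmod (u : nat -> C) (l : C) (c : R) :
  Ctends u l -> (forall n, c <= Cmod (u n))%R -> (c <= Cmod l)%R.
Proof.
intros Hu Hc.
assert (H : is_lim_seq (fun n => Cmod l + Cmod (u n - l))%R (Cmod l + 0)%R)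
  by (apply is_lim_seq_plus'; [apply is_lim_seq_const|exact Hu]).
rewrite Rplus_0_r in H.
refine (is_lim_seq_le (fun _ => c) _ c (Cmod l) _ (is_lim_seq_const c) H).
intros n. eapply Rle_trans; [apply (Hc n)|].
replace (u n) with (l + (u n - l)) at 1 by ring. apply Cmod_triangle.
Qed.

Lemma Ctends_shift (u : nat -> C) (l : C) (k : nat) :
  Ctends u l -> Ctends (fun n => u (n + k)%nat) l.
Proof. intros H. apply (is_lim_seq_incr_n (fun n => Cmod (u n - l)) k). exact H. Qed.

(** Truncated subtraction repeats [u 0] for [n < k], which does not affect the limit. *)
Lemma Ctends_unshift (u : nat -> C) (l : C) (k : nat) :
  Ctends u l -> Ctends (fun n => u (n - k)%nat) l.
Proof.
intros H. apply (is_lim_seq_incr_n (fun n => Cmod (u (n - k)%nat - l)) k).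
apply is_lim_seq_ext with (2 := H). intros n. now rewrite Nat.add_sub.
Qed.

(** * Bounded sequences and sequences bounded away from zero *)

Definition Cbounded (u : nat -> C) : Prop :=
  exists K, forall n, (Cmod (u n) <= K)%R.

(** A uniform lower bound survives passage to the limit and bounds the reciprocals; nonvanishing of
    each term would give neither. *)
Definition Caway (u : nat -> C) : Prop :=
  exists c, (0 < c)%R /\ forall n, (c <= Cmod (u n))%R.

Lemma Cbounded_mult (u v : nat -> C) :
  Cbounded u -> Cbounded v -> Cbounded (fun n => u n * v n).
Proof.
intros [K HK] [L HL]. exists (K * L)%R. intros n. rewrite Cmod_mult.
apply Rmult_le_compat; auto using Cmod_ge_0.
Qed.

Lemma Caway_mult (u v : nat -> C) :
  Caway u -> Caway v -> Caway (fun n => u n * v n).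
Proof.
intros [K [K0 HK]] [L [L0 HL]]. exists (K * L)%R.
split; [now apply Rmult_lt_0_compat|]. intros n. rewrite Cmod_mult.
apply Rmult_le_compat; auto; lra.
Qed.

Lemma Caway_nz (u : nat -> C) (n : nat) : Caway u -> u n <> 0.
Proof. intros [c [c0 H]] E. specialize (H n). rewrite E, Cmod_0 in H. lra. Qed.

Lemma Caway_lim (u : nat -> C) (l : C) : Caway u -> Ctends u l -> l <> 0.
Proof.
intros [c [c0 H]] Hl E. generalize (Ctends_le_Cmod u l c Hl H).
rewrite E, Cmod_0. lra.
Qed.

Lemma Cbounded_inv (u : nat -> C) : Caway u -> Cbounded (fun n => / u n).
Proof.
intros H. assert (Hn := fun n => Caway_nz u n H). destruct H as [c [c0 H]].
exists (/ c)%R. intros n. rewrite Cmod_inv by apply Hn.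
apply Rinv_le_contravar; auto.
Qed.

Lemma Ctends_inv (u : nat -> C) (l : C) :
  Caway u -> Ctends u l -> Ctends (fun n => / u n) (/ l).
Proof.
intros H Hu. assert (Hl := Caway_lim u l H Hu).
assert (Hn := fun n => Caway_nz u n H).
destruct (Cbounded_inv u H) as [K HK].
apply Ctends_le with (fun n => K * / Cmod l * Cmod (u n - l))%R.
- intros n. replace (/ u n - / l) with (- (/ u n * / l * (u n - l)))
    by (field; auto).
  rewrite Cmod_opp, !Cmod_mult, (Cmod_inv l) by exact Hl.
  apply Rmult_le_compat_r; [apply Cmod_ge_0|].
  apply Rmult_le_compat_r; [|apply HK].
  apply Rlt_le, Rinv_0_lt_compat, Cmod_gt_0, Hl.
- replace 0%R with (K * / Cmod l * 0)%R by ring.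
  apply is_lim_seq_mult'; [apply is_lim_seq_const|exact Hu].
Qed.

Lemma Ctends_div (u v : nat -> C) (l m : C) :
  Caway v -> Ctends u l -> Ctends v m -> Ctends (fun n => u n / v n) (l / m).
Proof. intros. apply Ctends_mult; [|apply Ctends_inv]; assumption. Qed.

(** * Tannery's theorem for sums of growing length *)

Lemma Cmod_sum_n_le (u : nat -> C) (n : nat) :
  (Cmod (sum_n u n) <= sum_n (fun k => Cmod (u k)) n)%R.
Proof.
induction n as [|n IH].
- rewrite Csum_0, sum_O. apply Rle_refl.
- rewrite Csum_S, sum_Sn. eapply Rle_trans; [apply Cmod_triangle|].
  apply Rplus_le_compat_r, IH.
Qed.

(** Split at a fixed [J]: the geometric bound makes the tail small uniformly in [N], and the head
    consists of finitely many sequences tending to 0. *)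
Lemma sum_n_dominated_lim (d : nat -> nat -> R) (K rho : R) :
  (0 <= rho < 1)%R ->
  (forall N j, (j <= N)%nat -> 0 <= d N j <= K * rho ^ j)%R ->
  (forall j, is_lim_seq (fun N => d N j) 0) ->
  is_lim_seq (fun N => sum_n (d N) N) 0.
Proof.
intros Hrho Hd Hlim.
assert (Htail : forall J M N, (J + M <= N)%nat ->
  (sum_n (d N) (J + M) <= sum_n (d N) J + K * rho ^ (S J) * (1 - rho ^ M) / (1 - rho))%R).
{ intros J M N. induction M as [|M IH]; intros HN.
  - rewrite Nat.add_0_r. simpl.
    replace (1 - 1)%R with 0%R by ring. unfold Rdiv. rewrite Rmult_0_r, Rmult_0_l, Rplus_0_r.
    apply Rle_refl.
  - rewrite Nat.add_succ_r, sum_Sn. unfold plus; simpl.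
    specialize (IH ltac:(lia)).
    destruct (Hd N (S (J + M)) ltac:(lia)) as [_ H2].
    eapply Rle_trans; [apply Rplus_le_compat; [exact IH|exact H2]|].
    rewrite Rplus_assoc. apply Rplus_le_compat_l.
    right. simpl. rewrite pow_add. field. lra. }
assert (Hpart : forall J, is_lim_seq (fun N => sum_n (d N) J) 0).
{ induction J as [|J IH].
  - apply is_lim_seq_ext with (2 := Hlim 0%nat). intros N. now rewrite sum_O.
  - apply is_lim_seq_ext with (fun N => (sum_n (d N) J + d N (S J))%R).
    + intros N. now rewrite sum_Sn.
    + replace 0%R with (0 + 0)%R by ring. now apply is_lim_seq_plus'. }
assert (K0 : (0 <= K)%R) by (generalize (Hd 0%nat 0%nat (le_n 0)); simpl; lra).
assert (Hgeom : is_lim_seq (fun J => K * rho / (1 - rho) * rho ^ J)%R 0).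
{ replace 0%R with (K * rho / (1 - rho) * 0)%R by ring.
  apply is_lim_seq_mult'; [apply is_lim_seq_const|].
  apply is_lim_seq_geom. rewrite Rabs_pos_eq; lra. }
apply is_lim_seq_spec. intros eps.
assert (P : (0 < eps / 2)%R) by (destruct eps; simpl; lra).
(* [J] brings the geometric tail below [eps / 2]; [N0] then does the same for the head. *)
apply is_lim_seq_spec in Hgeom. destruct (Hgeom (mkposreal _ P)) as [J HJ].
specialize (HJ J (le_n J)).
generalize (Hpart J). intros HpJ. apply is_lim_seq_spec in HpJ.
destruct (HpJ (mkposreal _ P)) as [N0 HN0].
exists (N0 + J)%nat. intros N HN. specialize (HN0 N ltac:(lia)).
simpl in HJ, HN0. rewrite Rminus_0_r in *.
assert (Hpos : forall M, (M <= N)%nat -> (0 <= sum_n (d N) M)%R).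
{ induction M as [|M IH]; intros HM.
  - rewrite sum_O. apply Hd, HM.
  - rewrite sum_Sn. apply Rplus_le_le_0_compat; [apply IH; lia|apply Hd, HM]. }
rewrite Rabs_pos_eq by (apply Hpos; lia).
specialize (Htail J (N - J)%nat N ltac:(lia)).
replace (J + (N - J))%nat with N in Htail by lia.
apply Rabs_def2 in HJ. apply Rabs_def2 in HN0.
assert (K * rho ^ S J * (1 - rho ^ (N - J)) / (1 - rho)
  <= K * rho / (1 - rho) * rho ^ J)%R.
{ replace (K * rho / (1 - rho) * rho ^ J)%R with (K * rho ^ S J * 1 / (1 - rho))%R
    by (simpl; field; lra).
  apply Rmult_le_compat_r; [apply Rlt_le, Rinv_0_lt_compat; lra|].
  apply Rmult_le_compat_l; [apply Rmult_le_pos; [exact K0|apply pow_le; lra]|].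
  generalize (pow_le rho (N - J) ltac:(lra)). lra. }
lra.
Qed.

Lemma geom_dominated_series (t : nat -> C) (K rho : R) :
  (0 <= rho < 1)%R -> (forall j, Cmod (t j) <= K * rho ^ j)%R ->
  Ctends (sum_n t) (CSeries t).
Proof.
intros Hrho Ht. apply ex_series_sum_n with (1 := Ht).
apply (ex_series_scal_l K (fun j => rho ^ j)%R).
apply ex_series_geom. rewrite Rabs_pos_eq; lra.
Qed.

(** Each summand is [t j * W] plus an error dominated by [K (L + |W|) rho^j] that vanishes as [N]
    grows. A single [W] serves all [j], since the limiting weights in Bailey's lemma do not depend
    on the index. *)
Lemma tannery (t : nat -> C) (w : nat -> nat -> C) (W : C) (K L rho : R) :
  (0 <= rho < 1)%R ->
  (forall j, Cmod (t j) <= K * rho ^ j)%R ->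
  (forall N j, (j <= N)%nat -> Cmod (w N j) <= L)%R ->
  (forall j, Ctends (fun N => w N j) W) ->
  Ctends (fun N => sum_n (fun j => t j * w N j) N) (CSeries t * W).
Proof.
intros Hrho Ht Hw HW.
apply Ctends_ext with
  (fun N => sum_n t N * W + sum_n (fun j => t j * (w N j - W)) N).
{ intros N. rewrite Cmult_comm, <- Csum_mult_l, <- Csum_plus.
  apply Csum_eq. intros j _. eqC. ring. }
rewrite <- (Cplus_0_r (CSeries t * W)).
apply Ctends_plus.
{ apply Ctends_mult; [|apply Ctends_const]. now apply geom_dominated_series with K rho. }
apply Ctends_le with (fun N => sum_n (fun j => Cmod (t j * (w N j - W))) N).
{ intros N. assert (E : forall s : C, s - 0 = s) by (intros; ring).
  rewrite E. apply Cmod_sum_n_le. }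
apply sum_n_dominated_lim with (K * (L + Cmod W))%R rho; [exact Hrho| |].
- intros N j Hj. split; [apply Cmod_ge_0|]. rewrite Cmod_mult.
  replace (K * (L + Cmod W) * rho ^ j)%R with (K * rho ^ j * (L + Cmod W))%R by ring.
  apply Rmult_le_compat; try apply Cmod_ge_0; [apply Ht|].
  eapply Rle_trans; [apply Cmod_triangle|]. rewrite Cmod_opp.
  apply Rplus_le_compat_r, Hw, Hj.
- intros j. apply is_lim_seq_ext with (fun N => Cmod (t j) * Cmod (w N j - W))%R.
  { intros N. now rewrite Cmod_mult. }
  replace 0%R with (Cmod (t j) * 0)%R by ring.
  apply is_lim_seq_mult'; [apply is_lim_seq_const|apply HW].
Qed.

(** * Infinite q-Pochhammer symbols *)

Lemma Cmod_1_minus_le (u : C) : (Cmod (1 - u) <= 1 + Cmod u)%R.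
Proof.
eapply Rle_trans; [apply Cmod_triangle|]. rewrite Cmod_1, Cmod_opp. lra.
Qed.

Lemma Cmod_1_minus_ge (u : C) : (1 - Cmod u <= Cmod (1 - u))%R.
Proof.
assert (H := Cmod_triangle (1 - u) u).
replace (1 - u + u) with (RtoC 1) in H by ring. rewrite Cmod_1 in H. lra.
Qed.

Lemma geom_partial_le (r : R) (n : nat) :
  (0 <= r < 1)%R -> ((1 - r ^ n) / (1 - r) <= / (1 - r))%R.
Proof.
intros Hr. unfold Rdiv. rewrite <- (Rmult_1_l (/ (1 - r))) at 2.
apply Rmult_le_compat_r; [apply Rlt_le, Rinv_0_lt_compat; lra|].
generalize (pow_le r n ltac:(lra)). lra.
Qed.

Lemma geom_partial_S (r : R) (n : nat) :
  (r < 1)%R -> ((1 - r ^ S n) / (1 - r) = (1 - r ^ n) / (1 - r) + r ^ n)%R.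
Proof. intros Hr. simpl. field. lra. Qed.

Lemma exp_le_compat (x y : R) : (x <= y)%R -> (exp x <= exp y)%R.
Proof. intros [H| ->]; [now apply Rlt_le, exp_increasing|apply Rle_refl]. Qed.

(** Each factor is at most [1 + |x| |p|^k <= exp (|x| |p|^k)] in modulus, and the exponents form a
    geometric sum. *)
Lemma qpoch_bounded (x p : C) : (Cmod p < 1)%R -> Cbounded (qpoch x p).
Proof.
intros Hp. assert (Hp0 := Cmod_ge_0 p). assert (Hx := Cmod_ge_0 x).
set (r := Cmod p) in *. exists (exp (Cmod x * / (1 - r))).
assert (H : forall n, (Cmod (qpoch x p n) <= exp (Cmod x * ((1 - r ^ n) / (1 - r))))%R).
{ induction n as [|n IH].
  - simpl. rewrite Cmod_1. right.
    replace (Cmod x * ((1 - 1) / (1 - r)))%R with 0%R by (field; lra).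
    symmetry. apply exp_0.
  - rewrite qpoch_S, Cmod_mult, geom_partial_S, Rmult_plus_distr_l, exp_plus by exact Hp.
    apply Rmult_le_compat; try apply Cmod_ge_0; [exact IH|].
    eapply Rle_trans; [apply Cmod_1_minus_le|].
    rewrite Cmod_mult, Cmod_pow. apply exp_ineq1_le. }
intros n. eapply Rle_trans; [apply H|].
apply exp_le_compat, Rmult_le_compat_l; [exact Hx|]. apply geom_partial_le. lra.
Qed.

(** Inverting, [1 / (1 - u) = 1 + u / (1 - u) <= 1 + u / (1 - t) <= exp (u / (1 - t))]. *)
Lemma one_minus_ge_exp (t u : R) :
  (0 <= u <= t)%R -> (t < 1)%R -> (exp (- (u / (1 - t))) <= 1 - u)%R.
Proof.
intros Hu Ht. rewrite exp_Ropp.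
assert (H := exp_ineq1_le (u / (1 - t))).
assert (H2 : (/ (1 - u) <= 1 + u / (1 - t))%R).
{ replace (/ (1 - u))%R with (1 + u / (1 - u))%R by (field; lra).
  apply Rplus_le_compat_l, Rmult_le_compat_l; [lra|].
  apply Rinv_le_contravar; lra. }
rewrite <- (Rinv_inv (1 - u)).
apply Rinv_le_contravar; [apply Rinv_0_lt_compat; lra|lra].
Qed.

(** Since [|x| < 1], each factor has modulus at least [1 - |x| |p|^k >= exp (- s |p|^k)] with
    [s = |x| / (1 - |x|)]; the exponents again sum geometrically. *)
Lemma qpoch_away (x p : C) : (Cmod x < 1)%R -> (Cmod p < 1)%R -> Caway (qpoch x p).
Proof.
intros Hx Hp. assert (Hp0 := Cmod_ge_0 p). assert (Hx0 := Cmod_ge_0 x).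
set (r := Cmod p) in *. set (t := Cmod x) in *. set (s := (t / (1 - t))%R).
assert (Hs : (0 <= s)%R).
{ apply Rmult_le_pos; [lra|]. apply Rlt_le, Rinv_0_lt_compat. lra. }
exists (exp (- (s * / (1 - r)))). split; [apply exp_pos|].
assert (H : forall n, (exp (- (s * ((1 - r ^ n) / (1 - r)))) <= Cmod (qpoch x p n))%R).
{ induction n as [|n IH].
  - simpl. rewrite Cmod_1. right.
    replace (- (s * ((1 - 1) / (1 - r))))%R with 0%R by (field; lra).
    apply exp_0.
  - rewrite qpoch_S, Cmod_mult, geom_partial_S, Rmult_plus_distr_l,
      Ropp_plus_distr, exp_plus by exact Hp.
    apply Rmult_le_compat; try (apply Rlt_le, exp_pos); [exact IH|].
    eapply Rle_trans; [|apply Cmod_1_minus_ge].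
    rewrite Cmod_mult, Cmod_pow. fold t r.
    assert (0 <= r ^ n <= 1)%R.
    { split; [apply pow_le; lra|]. rewrite <- (pow1 n). apply pow_incr. lra. }
    replace (s * r ^ n)%R with (t * r ^ n / (1 - t))%R by (unfold s; field; lra).
    apply one_minus_ge_exp; [|exact Hx]. split; [nra|].
    rewrite <- (Rmult_1_r t) at 2. apply Rmult_le_compat_l; lra. }
intros n. eapply Rle_trans; [|apply H].
apply exp_le_compat, Ropp_le_contravar, Rmult_le_compat_l; [exact Hs|].
apply geom_partial_le. lra.
Qed.

(** The differences of consecutive symbols, [- (x;p)_n x p^n], are dominated geometrically, so their
    telescoping series converges. *)
Lemma qpoch_tends (x p : C) : (Cmod p < 1)%R -> Ctends (qpoch x p) (qpoch_inf x p).
Proof.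
intros Hp. assert (Hp0 := Cmod_ge_0 p).
destruct (qpoch_bounded x p Hp) as [K HK].
set (d := fun n => - (qpoch x p n * x * p ^ n)).
assert (Hd : Ctends (sum_n d) (CSeries d)).
{ apply geom_dominated_series with (K * Cmod x)%R (Cmod p); [lra|].
  intros n. unfold d. rewrite Cmod_opp, !Cmod_mult, Cmod_pow.
  apply Rmult_le_compat_r; [apply pow_le; exact Hp0|].
  apply Rmult_le_compat_r; [apply Cmod_ge_0|apply HK]. }
assert (Hsum : forall n, 1 + sum_n d n = qpoch x p (n + 1)).
{ intros n. rewrite Nat.add_1_r. induction n as [|n IH].
  - rewrite Csum_0. unfold d. simpl. eqC. ring.
  - rewrite Csum_S, Cplus_assoc, IH, (qpoch_S _ _ (S n)). unfold d. eqC. ring. }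
assert (H : Ctends (qpoch x p) (1 + CSeries d)).
{ apply (is_lim_seq_incr_n (fun n => Cmod (qpoch x p n - (1 + CSeries d))) 1).
  change (Ctends (fun n => qpoch x p (n + 1)) (1 + CSeries d)).
  apply Ctends_ext with (1 := Hsum).
  apply Ctends_plus; [apply Ctends_const|exact Hd]. }
unfold qpoch_inf. now rewrite (Ctends_CLim _ _ H).
Qed.

Lemma qpoch_0 (p : C) (n : nat) : qpoch 0 p n = 1.
Proof. induction n as [|n IH]; [reflexivity|]. rewrite qpoch_S, IH. ring. Qed.

(** For [x = q] and [p = q^2] this turns [(q;p)_n / (q^3;p)_n] into [(1 - q) / (1 - q^(2n+1))], the
    source of the factor [1 - q^(2n+1)] in [beta_n]. *)
Lemma qpoch_shift (x p : C) (n : nat) :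
  qpoch x p n * (1 - x * p ^ n) = (1 - x) * qpoch (x * p) p n.
Proof.
change (qpoch x p n * (1 - x * p ^ n)) with (qpoch x p (S n)).
change (S n) with (1 + n)%nat. rewrite qpoch_add. simpl.
rewrite !Cmult_1_r. ring.
Qed.

(** * Bounds for the terms of both series *)

Lemma theta_bounded (q : C) : (Cmod q < 1)%R -> Cbounded (theta q).
Proof.
intros Hq. assert (Hq0 := Cmod_ge_0 q). set (r := Cmod q) in *.
exists (1 + 2 * / (1 - r))%R.
assert (Hpow : forall n, (0 <= r ^ n <= 1)%R).
{ intros n. split; [apply pow_le; lra|]. rewrite <- (pow1 n). apply pow_incr. lra. }
assert (H : forall n, (Cmod (theta q n) <= 1 + 2 * ((1 - r ^ n) / (1 - r)))%R).
{ induction n as [|n IH].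
  - unfold theta. rewrite sum_sym_0. simpl. rewrite Cmod_1. right. field. lra.
  - rewrite theta_S, geom_partial_S by exact Hq.
    eapply Rle_trans; [apply Cmod_triangle|].
    rewrite Rmult_plus_distr_l, <- Rplus_assoc.
    apply Rplus_le_compat; [exact IH|].
    rewrite Cmod_mult, Cmod_pow, Rmult_comm. fold r.
    apply Rmult_le_compat; [apply Cmod_ge_0|apply Hpow| |].
    + eapply Rle_trans; [apply Cmod_triangle|].
      rewrite Cmod_1, Cmod_pow. fold r. generalize (Hpow (2 * S n)%nat). lra.
    (* The exponent is at least [n], so the theta increment is at most [2 r^n] in modulus. *)
    + replace (S n * (2 * n + 1))%nat with (n + (2 * n * n + 2 * n + 1))%nat by ring.
      rewrite pow_add. rewrite <- (Rmult_1_r (r ^ n)) at 2.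
      apply Rmult_le_compat_l; apply Hpow. }
intros n. eapply Rle_trans; [apply H|].
apply Rplus_le_compat_l, Rmult_le_compat_l; [lra|]. apply geom_partial_le. lra.
Qed.

Lemma Cpow_bounded (q : C) (f : nat -> nat) :
  (Cmod q <= 1)%R -> Cbounded (fun n => q ^ f n).
Proof.
intros Hq. exists 1%R. intros n. rewrite Cmod_pow, <- (pow1 (f n)).
apply pow_incr. split; [apply Cmod_ge_0|exact Hq].
Qed.

Lemma Cbounded_1_plus (u : nat -> C) : Cbounded u -> Cbounded (fun n => 1 + u n).
Proof.
intros [K HK]. exists (1 + K)%R. intros n.
eapply Rle_trans; [apply Cmod_triangle|]. rewrite Cmod_1. apply Rplus_le_compat_l, HK.
Qed.

Lemma hecke_alpha_bounded (q : C) : (Cmod q < 1)%R -> Cbounded (hecke_alpha q).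
Proof.
intros Hq. unfold hecke_alpha.
apply Cbounded_mult; [|now apply theta_bounded].
apply Cbounded_mult; [|apply (Cpow_bounded q (fun n => (n * n)%nat)); lra].
apply Cbounded_mult.
- apply (Cpow_bounded _ (fun n => n)). rewrite Cmod_m1. lra.
- apply Cbounded_1_plus, (Cpow_bounded q (fun r => (2 * r + 1)%nat)). lra.
Qed.

Lemma one_minus_odd_pow_away (q : C) :
  (Cmod q < 1)%R -> Caway (fun n => 1 - q ^ (2 * n + 1)).
Proof.
intros Hq. exists (1 - Cmod q)%R. split; [lra|]. intros n.
eapply Rle_trans; [|apply Cmod_1_minus_ge].
apply Rplus_le_compat_l, Ropp_le_contravar.
rewrite Cmod_pow, Nat.add_1_r, <- tech_pow_Rmult.
assert (H : (Cmod q ^ (2 * n) <= 1 ^ (2 * n))%R)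
  by (apply pow_incr; generalize (Cmod_ge_0 q); lra).
rewrite pow1 in H. generalize (Cmod_ge_0 q). nra.
Qed.

Lemma sum_sym_mult_l (c : C) (f : Z -> C) (n : nat) :
  sum_sym (fun j => c * f j) n = c * sum_sym f n.
Proof. exact (Csum_mult_l c _ _). Qed.

Lemma hecke_term_eq (q a b : C) (n : nat) :
  hecke_term q a b n
  = (qpoch (q ^ 2 / a) (q ^ 2) n * qpoch (q ^ 2 / b) (q ^ 2) n)
    / (qpoch (a * q ^ 2) (q ^ 2) n * qpoch (b * q ^ 2) (q ^ 2) n)
    * (a * b) ^ n * hecke_alpha q n.
Proof.
unfold hecke_term, hecke_alpha, theta.
match goal with |- _ = ?x * (?y * ?s) => replace (x * (y * s)) with (x * y * s) by ring end.
rewrite <- sum_sym_mult_l. unfold sum_sym. apply Csum_eq. intros k _.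
cbv beta. set (j := (Z.of_nat k - Z.of_nat n)%Z).
(* Nonnegative for every integer [j], so each [Cpowz] here is a power with natural exponent and
   splits off [q^(n^2)]. *)
assert (Hj : (0 <= 2 * j ^ 2 - j)%Z) by nia.
destruct (Z_of_nat_complete _ Hj) as [i Hi].
replace (Z.of_nat n ^ 2 + 2 * j ^ 2 - j)%Z with (Z.of_nat (n * n + i)) by nia.
rewrite Hi, !Cpowz_nat, (Cpow_add_r q (n * n)). eqC. ring.
Qed.

Lemma Cbounded_geom (u : nat -> C) (z : C) : Cbounded u ->
  exists K, forall n, (Cmod (u n * z ^ n) <= K * Cmod z ^ n)%R.
Proof.
intros [K HK]. exists K. intros n. rewrite Cmod_mult, Cmod_pow.
apply Rmult_le_compat_r; [apply pow_le, Cmod_ge_0|apply HK].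
Qed.

(** * Passage to the limit in the truncated Bailey lemma *)

Theorem theorem3p8 :
  forall q a b : C,
    q <> 0 -> a <> 0 -> b <> 0 ->
    (Cmod q < 1)%R ->
    (Rmax (Cmod (a * b)) (Rmax (Cmod (a * q ^ 2)) (Cmod (b * q ^ 2))) < 1)%R ->
    ex_series (phi32_term (q ^ 2 / a) (q ^ 2 / b) q 0 (q ^ 3) (q ^ 2) (a * b)) /\
    ex_series (hecke_term q a b) /\
    (qpoch_inf (q ^ 2) (q ^ 2) * qpoch_inf (a * b) (q ^ 2))
      / (qpoch_inf (a * q ^ 2) (q ^ 2) * qpoch_inf (b * q ^ 2) (q ^ 2))
      * phi32 (q ^ 2 / a) (q ^ 2 / b) q 0 (q ^ 3) (q ^ 2) (a * b)
    = (1 - q) * CSeries (hecke_term q a b).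
Proof.
intros q a b Hq Ha Hb Hq1 Hmax.
assert (Hab := Rle_lt_trans _ _ _ (Rmax_l _ _) Hmax).
assert (Hmax2 := Rle_lt_trans _ _ _ (Rmax_r _ _) Hmax).
assert (Haq := Rle_lt_trans _ _ _ (Rmax_l _ _) Hmax2).
assert (Hbq := Rle_lt_trans _ _ _ (Rmax_r _ _) Hmax2).
clear Hmax Hmax2.
set (p := q ^ 2) in *. set (z := a * b) in *.
assert (Hp1 : (Cmod p < 1)%R).
{ unfold p. rewrite Cmod_pow. generalize (Cmod_ge_0 q). simpl. nra. }
assert (Hz : (0 <= Cmod z < 1)%R) by (split; [apply Cmod_ge_0|exact Hab]).
assert (Hp0 : p <> 0) by now apply Cpow_nz.
assert (Ap := qpoch_away p p Hp1 Hp1).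
assert (Aap := qpoch_away (a * p) p Haq Hp1).
assert (Abp := qpoch_away (b * p) p Hbq Hp1).
assert (Aq := one_minus_odd_pow_away q Hq1).
assert (Np := fun n => Caway_nz _ n Ap).
assert (Nap := fun n => Caway_nz _ n Aap).
assert (Nbp := fun n => Caway_nz _ n Abp).
assert (Nq := fun n => Caway_nz _ n Aq). cbv beta in Nq.
assert (Tp := qpoch_tends p p Hp1).
assert (Tap := qpoch_tends (a * p) p Hp1).
assert (Tbp := qpoch_tends (b * p) p Hp1).
assert (Tz := qpoch_tends z p Hp1).
assert (Lp := Caway_lim _ _ Ap Tp).
assert (Lap := Caway_lim _ _ Aap Tap).
assert (Lbp := Caway_lim _ _ Abp Tbp).
(* The summand of Bailey's lemma with [beta_j] inserted and without the weight depending on [N];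
   [1 - q] times it is the 3phi2 term. *)
set (t := fun j => qpoch (p / a) p j * qpoch (p / b) p j
  * / ((1 - q ^ (2 * j + 1)) * qpoch p p j) * z ^ j).
set (h := hecke_term q a b).
assert (Bt : exists K, forall n, (Cmod (t n) <= K * Cmod z ^ n)%R).
{ apply Cbounded_geom, Cbounded_mult.
  - apply Cbounded_mult; now apply qpoch_bounded.
  - apply Cbounded_inv. now apply Caway_mult. }
assert (Bh : exists K, forall n, (Cmod (h n) <= K * Cmod z ^ n)%R).
{ destruct (Cbounded_geom (fun n => qpoch (p / a) p n * qpoch (p / b) p n
    * / (qpoch (a * p) p n * qpoch (b * p) p n) * hecke_alpha q n) z) as [K HK].
  - apply Cbounded_mult; [|now apply hecke_alpha_bounded].
    apply Cbounded_mult; [apply Cbounded_mult; now apply qpoch_bounded|].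
    apply Cbounded_inv. now apply Caway_mult.
  - exists K. intros n. eapply Rle_trans; [|apply HK]. right. f_equal.
    unfold h. rewrite hecke_term_eq. fold p z. unfold Cdiv. ring. }
destruct Bt as [Kt Ht]. destruct Bh as [Kh Hh].
assert (St := geom_dominated_series t Kt _ Hz Ht).
assert (Sh := geom_dominated_series h Kh _ Hz Hh).
assert (Ephi : forall n, (1 - q) * t n
  = phi32_term (p / a) (p / b) q 0 (q ^ 3) p z n).
{ intros n. unfold phi32_term, t. rewrite qpoch_0.
  assert (E := qpoch_shift q p n).
  replace (q * p) with (q ^ 3) in E by (unfold p; ring).
  replace (q * p ^ n) with (q ^ (2 * n + 1)) in E
    by (unfold p; rewrite <- Cpow_mult_r, Nat.add_1_r, Cpow_S; reflexivity).
  assert (N3 : qpoch (q ^ 3) p n <> 0).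
  { apply Caway_nz, qpoch_away; [|exact Hp1].
    rewrite Cmod_pow. generalize (Cmod_ge_0 q). intros H0. simpl. nra. }
  replace (qpoch q p n)
    with ((1 - q) * qpoch (q ^ 3) p n / (1 - q ^ (2 * n + 1)))
    by (rewrite <- E; field; apply Nq).
  field. auto. }
assert (Sphi : Ctends (sum_n (phi32_term (p / a) (p / b) q 0 (q ^ 3) p z))
  ((1 - q) * CSeries t)).
{ apply Ctends_ext with (fun N => (1 - q) * sum_n t N).
  - intros N. rewrite <- Csum_mult_l. apply Csum_eq. intros n _. apply Ephi.
  - apply Ctends_mult; [apply Ctends_const|exact St]. }
split; [now apply ex_series_Ctends with (1 := Sphi)|].
split; [now apply ex_series_Ctends with (1 := Sh)|].
unfold phi32, CSeries at 1. rewrite (Ctends_CLim _ _ Sphi).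
destruct (qpoch_bounded z p Hp1) as [Mz HMz].
destruct (qpoch_bounded (a * p) p Hp1) as [Ma HMa].
destruct (qpoch_bounded (b * p) p Hp1) as [Mb HMb].
destruct (Cbounded_inv _ Ap) as [Mp HMp].
(* Tannery on the [beta] side: for fixed [j] the weight tends to [(z;p)_inf / (p;p)_inf]. *)
assert (L1 : Ctends (fun N => sum_n (fun j =>
    t j * (qpoch z p (N - j) / qpoch p p (N - j))) N)
  (CSeries t * (qpoch_inf z p / qpoch_inf p p))).
{ apply tannery with Kt (Mz * Mp)%R (Cmod z); [exact Hz|exact Ht| |].
  - intros N j _. unfold Cdiv. rewrite Cmod_mult.
    apply Rmult_le_compat; auto using Cmod_ge_0.
  - intros j. apply (Ctends_unshift (fun n => qpoch z p n / qpoch p p n)).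
    now apply Ctends_div. }
(* On the [alpha] side the index shifts by [r] and [r + 1] vanish in the limit, so all weights share
   one limit. *)
assert (L2 : Ctends (fun N => sum_n (fun r =>
    h r * (qpoch (a * p) p N * qpoch (b * p) p N
       / (qpoch p p (N - r) * qpoch p p (N + r + 1)))) N)
  (CSeries h * (qpoch_inf (a * p) p * qpoch_inf (b * p) p
     / (qpoch_inf p p * qpoch_inf p p)))).
{ apply tannery with Kh (Ma * Mb * (Mp * Mp))%R (Cmod z); [exact Hz|exact Hh| |].
  - intros N j _. unfold Cdiv.
    replace (/ (qpoch p p (N - j) * qpoch p p (N + j + 1)))
      with (/ qpoch p p (N - j) * / qpoch p p (N + j + 1)) by (field; auto).
    rewrite !Cmod_mult.
    repeat apply Rmult_le_compat; auto using Cmod_ge_0;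
      apply Rmult_le_pos; apply Cmod_ge_0.
  - intros r.
    apply Ctends_ext with (fun N => qpoch (a * p) p N * qpoch (b * p) p N
       * (/ qpoch p p (N - r) * / qpoch p p (N + (r + 1)))).
    { intros N. rewrite Nat.add_assoc. field. auto. }
    unfold Cdiv.
    replace (/ (qpoch_inf p p * qpoch_inf p p))
      with (/ qpoch_inf p p * / qpoch_inf p p) by (field; auto).
    apply Ctends_mult; [now apply Ctends_mult|].
    apply Ctends_mult.
    + apply (Ctends_unshift (fun n => / qpoch p p n)). now apply Ctends_inv.
    + apply (Ctends_shift (fun n => / qpoch p p n)). now apply Ctends_inv. }
assert (E : CSeries t * (qpoch_inf z p / qpoch_inf p p)
  = CSeries h * (qpoch_inf (a * p) p * qpoch_inf (b * p) p
     / (qpoch_inf p p * qpoch_inf p p))).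
{ apply Ctends_unique with (1 := L1). apply Ctends_ext with (2 := L2).
  intros N.
  transitivity (sum_n (fun r =>
    (qpoch (p / a) p r * qpoch (p / b) p r)
    / (qpoch (a * p) p r * qpoch (b * p) p r) * z ^ r * hecke_alpha q r
    * (qpoch (a * p) p N * qpoch (b * p) p N
       / (qpoch p p (N - r) * qpoch p p (N + r + 1)))) N).
  { apply Csum_eq. intros r _. unfold h. now rewrite hecke_term_eq. }
  unfold z at 1. rewrite <- bailey_finite by assumption. fold z.
  (* These occurrences of [p] lie in the inner sum, which must read [q ^ 2] for the Bailey pair. *)
  apply Csum_eq. intros j _. unfold p at 5 6 7 8.
  rewrite hecke_bailey_pair by (apply Np || apply Nq). fold p. unfold t.
  eqC. ring. }
(* [E] is multiplied by [(1 - q) (p;p)_inf^2 / ((ap;p)_inf (bp;p)_inf)]. *)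
transitivity ((1 - q) * (qpoch_inf p p * qpoch_inf p p)
  / (qpoch_inf (a * p) p * qpoch_inf (b * p) p)
  * (CSeries t * (qpoch_inf z p / qpoch_inf p p))); [field; auto|].
rewrite E. field. auto.
Qed.
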